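(* Let $R$ be a Noetherian unique factorization domain. Let $\mathcal{A}=(G,\epsilon,x)$ be an augmented group system with $d=1$, so that $G$ is a finitely presented group, $\epsilon: G\to \mathbb{Z}=\langle t \mid\ \rangle$ is an epimorphism, and $x\in G$ represents the distinguished conjugacy class; assume that $\epsilon(x)=t$. Assume that the kernel of $\epsilon: G\to\mathbb{Z}$ is a finitely generated free group of rank $n$. Then for any positive integer $N$ and any representation $\gamma: G\to \mathrm{GL}_N(R)$, the Alexander-Lin polynomial $D_\gamma(\mathcal{A})\in R[t^{\pm 1}]$ satisfies: 1. $\deg D_\gamma(\mathcal{A}) = nN$; 2. the leading and trailing coefficients of $D_\gamma(\mathcal{A})$ are units of $R$.
   Context: Augmented group system: a triple $\mathcal{A}=(G,\epsilon,x)$ consisting of a finitely presented group $G$, an epimorphism $\epsilon: G\to\mathbb{Z}^d$ ($d$ a positive integer), and the conjugacy class of an element $x\in G$ such that $\epsilon(x)$ is nontrivial. The group $\mathbb{Z}^d$ is written multiplicatively; when $d=1$ it is the infinite cyclic group generated by $t$. Here only $d=1$ is needed, and $\Lambda=R[t^{\pm1}]$ denotes the ring of Laurent polynomials in $t$ with coefficients in $R$. Alexander-Lin polynomial: Let $\langle x_0,x_1,\ldots,x_q \mid r_1,\ldots,r_m\rangle$ be a finite presentation of $G$ in which the generator $x_0$ represents $x$ and $m\ge q$ (such a presentation always exists). Let $F$ be the free group on $x_0,\ldots,x_q$. Given $\gamma: G\to\mathrm{GL}_N(R)$ with $\gamma(x_i)=X_i$, let $\Phi:\mathbb{Z}[F]\to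 M_N(\Lambda)$ be the ring homomorphism determined by $x_i\mapsto \epsilon(x_i)X_i$, where $M_N(\Lambda)$ is the ring of $N\times N$ matrices over $\Lambda$. Let $\mathcal{M}_\gamma$ be the $m\times q$ matrix with $(i,j)$ entry $\left(\partial r_i/\partial x_j\right)^\Phi\in M_N(\Lambda)$ for $1\le i\le m$, $1\le j\le q$, where $\partial r_i/\partial x_j\in\mathbb{Z}[F]$ is the Fox partial derivative and the superscript $\Phi$ denotes its image under $\Phi$ (the column corresponding to $x_0$ is omitted). Regard $\mathcal{M}_\gamma$ as an $mN\times qN$ matrix over $\Lambda$ by ignoring inner parentheses. Then $D_\gamma(\mathcal{A})$ is the greatest common divisor in $\Lambda$ of all $qN\times qN$ minors of $\mathcal{M}_\gamma$. It is well defined up to multiplication by units of $\Lambda$ and, up to such units, depends only on $\mathcal{A}$ and $\gamma$, not on the choice of presentation. Degree convention: since $D_\gamma(\mathcal{A})$ is a Laurent polynomial defined up to units, $\deg$ is the difference between the highest and lowest exponents of $t$ occurring with nonzero coefficient; the leading and trailing coefficients are the coefficients of the highest and lowest such powers of $t$. *)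

(* Defs.v *)
From HB Require Import structures.
From mathcomp Require Import all_boot all_order all_algebra finmap.
From mathcomp.multinomials Require Import monalg.

Set Implicit Arguments.
Unset Strict Implicit.
Unset Printing Implicit Defensive.

Import Order.TTheory GRing.Theory Num.Theory.
Local Open Scope ring_scope.

Notation "{ 'ghom' G -> H }" := (UMagmaMorphism.type G H)
  (G at level 98, H at level 99, format "{ 'ghom'  G  ->  H }") : type_scope.

Definition is_ideal (R : comNzRingType) (I : R -> Prop) : Prop :=
  [/\ I 0, forall a b, I a -> I b -> I (a + b) & forall c a, I a -> I (c * a)].

Definition noetherian (R : comNzRingType) : Prop :=
  forall I : R -> Prop, is_ideal I ->
    exists (k : nat) (s : 'I_k -> R),
      forall a, I a <-> exists c : 'I_k -> R, a = \sum_(i < k) c i * s i.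

Definition divides (R : comNzRingType) (a b : R) : Prop :=
  exists c, b = c * a.

Definition associated (R : comUnitRingType) (a b : R) : Prop :=
  exists2 u, u \is a GRing.unit & b = u * a.

Definition irreducible_elt (R : comUnitRingType) (a : R) : Prop :=
  [/\ a != 0, a \isn't a GRing.unit &
      forall b c, a = b * c -> b \is a GRing.unit \/ c \is a GRing.unit].

Definition ufd (R : idomainType) : Prop :=
  (forall a : R, a != 0 ->
     exists (u : R) (k : nat) (p : 'I_k -> R),
       [/\ u \is a GRing.unit, forall i, irreducible_elt (p i)
         & a = u * \prod_(i < k) p i]) /\
  (forall (k l : nat) (p : 'I_k -> R) (p' : 'I_l -> R),
     (forall i, irreducible_elt (p i)) ->
     (forall j, irreducible_elt (p' j)) ->
     associated (\prod_(i < k) p i) (\prod_(j < l) p' j) ->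
     exists2 s : 'I_k -> 'I_l, bijective s &
       forall i, associated (p i) (p' (s i))).

Definition is_gcd (R : comNzRingType) (S : R -> Prop) (d : R) : Prop :=
  (forall a, S a -> divides d a) /\
  (forall e, (forall a, S a -> divides e a) -> divides e d).

(* The group ring R[G], carried by the finitely supported functions G -> R;
   the ring structure of monalg is not available for groups, because its
   monoids are required to have no non-trivial units. *)
Definition group_ring (R : nzRingType) (G : groupType) : Type := {malg R[G]}.

Section GroupRing.
Variables (R : nzRingType) (G : groupType).

HB.instance Definition _ := GRing.Lmodule.copy (group_ring R G) {malg R[G]}.

Implicit Types f g h : group_ring R G.

Definition grelt (c : R) (x : G) : group_ring R G := mkmalgU x c.
Definition grone : group_ring R G := grelt 1 1%g.

(* locked, since unfolding the product makes failed unifications very slow *)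
Fact grmul_key : unit. Proof. exact: tt. Qed.
Definition grmul : group_ring R G -> group_ring R G -> group_ring R G :=
  locked_with grmul_key (fun f g =>
    \sum_(x <- msupp f) \sum_(y <- msupp g) grelt (f@_x * g@_y) (x * y)%g).

Lemma grmul_def f g :
  grmul f g =
  \sum_(x <- msupp f) \sum_(y <- msupp g) grelt (f@_x * g@_y) (x * y)%g.
Proof. by rewrite /grmul unlock. Qed.

Lemma grelt0 x : grelt 0 x = 0. Proof. exact: monalgU0. Qed.
Lemma greltD x : {morph grelt^~ x : a b / a + b}.
Proof. exact: monalgUD. Qed.

Lemma gr_suppD f g : (msupp (f + g) `<=` msupp f `|` msupp g)%fset.
Proof. exact: msuppD_le. Qed.
Lemma gr_coefD f g x : (f + g)@_x = f@_x + g@_x.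
Proof. exact: mcoeffD. Qed.

Lemma grmul_wide (d1 d2 : {fset G}) f g :
  (msupp f `<=` d1)%fset -> (msupp g `<=` d2)%fset ->
  grmul f g = \sum_(x <- d1) \sum_(y <- d2) grelt (f@_x * g@_y) (x * y)%g.
Proof.
move=> le1 le2; rewrite grmul_def (big_fset_incl _ le1) /=.
  apply/eq_bigr=> x _; apply/big_fset_incl => // y _ /mcoeff_outdom ->.
  by rewrite mulr0 grelt0.
move=> x _ /mcoeff_outdom fx.
by rewrite big1 // => y _; rewrite fx mul0r grelt0.
Qed.

Lemma grmulE c d x y :
  grmul (grelt c x) (grelt d y) = grelt (c * d) (x * y)%g.
Proof. by rewrite (grmul_wide msuppU_le msuppU_le) !big_seq_fset1 !mcoeffUU. Qed.

Lemma grmulDl : left_distributive grmul +%R.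
Proof.
move=> f g h.
rewrite [in RHS](grmul_wide (fsubsetUl _ (msupp g)) (fsubset_refl _)).
rewrite [in RHS](grmul_wide (fsubsetUr (msupp f) _) (fsubset_refl _)).
rewrite (grmul_wide (gr_suppD _ _) (fsubset_refl _)).
rewrite -big_split /=; apply/eq_bigr=> x _.
rewrite -big_split /=; apply/eq_bigr=> y _.
by rewrite gr_coefD mulrDl greltD.
Qed.

Lemma grmulDr : right_distributive grmul +%R.
Proof.
move=> h f g.
rewrite [in RHS](grmul_wide (fsubset_refl _) (fsubsetUl _ (msupp g))).
rewrite [in RHS](grmul_wide (fsubset_refl _) (fsubsetUr (msupp f) _)).
rewrite (grmul_wide (fsubset_refl _) (gr_suppD _ _)).
rewrite -big_split /=; apply/eq_bigr=> x _.
rewrite -big_split /=; apply/eq_bigr=> y _.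
by rewrite gr_coefD mulrDr greltD.
Qed.

Lemma grmul0l : left_zero 0 grmul.
Proof. by move=> f; rewrite grmul_def msupp0 big_seq_fset0. Qed.

Lemma grmul0r : right_zero 0 grmul.
Proof.
by move=> f; rewrite grmul_def big1 // => x _; rewrite msupp0 big_seq_fset0.
Qed.

Lemma grE f : f = \sum_(x <- msupp f) grelt f@_x x.
Proof. exact: monalgE. Qed.

Lemma gr_ind (P : group_ring R G -> Prop) :
  P 0 -> (forall f g, P f -> P g -> P (f + g)) ->
  (forall c x, P (grelt c x)) -> forall f, P f.
Proof.
by move=> P0 PD PU f; rewrite (grE f); elim/big_rec: _ => // x g _; apply: PD.
Qed.

Lemma grmulA : associative grmul.
Proof.
move=> f g h; elim/gr_ind: f => [|f1 f2 e1 e2|c x].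
- by rewrite !grmul0l.
- by rewrite !grmulDl e1 e2.
elim/gr_ind: g => [|g1 g2 e1 e2|d y].
- by rewrite !(grmul0l, grmul0r).
- by rewrite !(grmulDl, grmulDr) e1 e2.
elim/gr_ind: h => [|h1 h2 e1 e2|e z].
- by rewrite !grmul0r.
- by rewrite !grmulDr e1 e2.
by rewrite !grmulE mulrA mulgA.
Qed.

Lemma grmul1l : left_id grone grmul.
Proof.
move=> f; elim/gr_ind: f => [|f1 f2 e1 e2|c x].
- exact: grmul0r.
- by rewrite grmulDr e1 e2.
by rewrite grmulE mul1r mul1g.
Qed.

Lemma grmul1r : right_id grone grmul.
Proof.
move=> f; elim/gr_ind: f => [|f1 f2 e1 e2|c x].
- exact: grmul0l.
- by rewrite grmulDl e1 e2.
by rewrite grmulE mulr1 mulg1.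
Qed.

Lemma grone_neq0 : grone != 0.
Proof. by rewrite monalgU_eq0 oner_eq0. Qed.

HB.instance Definition _ := GRing.Zmodule_isNzRing.Build (group_ring R G)
  grmulA grmul1l grmul1r grmulDl grmulDr grone_neq0.

Lemma grelt_mul c d x y : grelt c x * grelt d y = grelt (c * d) (x * y)%g.
Proof. exact: grmulE. Qed.

End GroupRing.

(* Zt is the infinite cyclic group, written multiplicatively: the integer k
   stands for t ^ k, and the group law is the addition of exponents. *)
Definition Zt : groupType := GRing.to_multiplicative int.
Definition tgen : Zt := (1 : int).

Definition laurent (R : comNzRingType) : Type := group_ring R Zt.

Section Laurent.
Variable R : comNzRingType.

HB.instance Definition _ := GRing.NzRing.copy (laurent R) (group_ring R Zt).

Lemma laurent_mulC : commutative (@GRing.mul (laurent R)).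
Proof.
move=> f g; elim/gr_ind: f => [|f1 f2 e1 e2|c x].
- by rewrite mul0r mulr0.
- by rewrite mulrDl mulrDr e1 e2.
elim/gr_ind: g => [|g1 g2 e1 e2|d y].
- by rewrite mul0r mulr0.
- by rewrite mulrDl mulrDr e1 e2.
by rewrite !grelt_mul mulrC; congr grelt; apply: addrC.
Qed.

HB.instance Definition _ :=
  GRing.PzRing_hasCommutativeMul.Build (laurent R) laurent_mulC.

Definition lconst (c : R) : laurent R := grelt c 1%g.
Definition lmon (k : Zt) : laurent R := grelt 1 k.

(* exponents of t occurring in f, in increasing order; for f = 0 the degree and
   both extreme coefficients below are 0 *)
Definition lexps (f : laurent R) : seq int :=
  sort <=%R (enum_fset (msupp f) : seq int).
Definition lowexp (f : laurent R) : int := head 0 (lexps f).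
Definition highexp (f : laurent R) : int := last 0 (lexps f).
Definition ldeg (f : laurent R) : int := highexp f - lowexp f.
Definition leading_coef (f : laurent R) : R := mcoeff (highexp f : Zt) f.
Definition trailing_coef (f : laurent R) : R := mcoeff (lowexp f : Zt) f.

End Laurent.

Section GeneralLinear.
Variables (R : comUnitRingType) (N : nat).

Record GL : Type := MkGL { glval :> 'M[R]_N; _ : glval \in unitmx }.

HB.instance Definition _ := [isSub for glval].
HB.instance Definition _ := [Choice of GL by <:].

Implicit Types g h : GL.

Lemma gl_unit g : (g : 'M_N) \in unitmx. Proof. exact: valP. Qed.

Fact gl1_subproof : (1%:M : 'M[R]_N) \in unitmx. Proof. exact: unitmx1. Qed.
Fact glM_subproof g h : (g *m h : 'M_N) \in unitmx.
Proof. by rewrite unitmx_mul !gl_unit. Qed.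
Fact glV_subproof g : invmx g \in unitmx.
Proof. by rewrite unitmx_inv gl_unit. Qed.

Definition gl1 : GL := MkGL gl1_subproof.
Definition glM g h : GL := MkGL (glM_subproof g h).
Definition glV g : GL := MkGL (glV_subproof g).

Fact glMA : associative glM.
Proof. by move=> f g h; apply: val_inj; apply: mulmxA. Qed.
Fact gl1M : left_id gl1 glM.
Proof. by move=> g; apply: val_inj; apply: mul1mx. Qed.
Fact glM1 : right_id gl1 glM.
Proof. by move=> g; apply: val_inj; apply: mulmx1. Qed.
Fact glVM : left_inverse gl1 glV glM.
Proof. by move=> g; apply: val_inj; apply: mulVmx; apply: gl_unit. Qed.
Fact glMV : right_inverse gl1 glV glM.
Proof. by move=> g; apply: val_inj; apply: mulmxV; apply: gl_unit. Qed.

HB.instance Definition _ := isGroup.Build GL glMA gl1M glM1 glVM glMV.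

End GeneralLinear.

(* The free group on I: reduced words, where (i, true) is the generator x_i
   and (i, false) its inverse. *)
Section FreeGroup.
Variable I : choiceType.

Definition letter : Type := (I * bool)%type.
Implicit Types (a b : letter) (u v w : seq letter).

Definition linv a : letter := (a.1, ~~ a.2).
Definition reduced w : bool := sorted (fun a b => b != linv a) w.

Record free_group : Type := FreeGroup { fgval :> seq letter; _ : reduced fgval }.

HB.instance Definition _ := [isSub for fgval].
HB.instance Definition _ := [Choice of free_group by <:].

Definition wcons a w : seq letter :=
  if w is b :: w' then if b == linv a then w' else a :: w else [:: a].
Definition wmul u v : seq letter := foldr wcons v u.
Definition winv u : seq letter := rev (map linv u).

Lemma linvK : involutive linv.
Proof. by case=> i e; rewrite /linv /= negbK. Qed.

Lemma linv_neq a : a != linv a.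
Proof. by case: a => i []; rewrite /linv xpair_eqE /= andbF. Qed.

Lemma reduced_wcons a w : reduced w -> reduced (wcons a w).
Proof.
case: w => [|b w] //= rw; case: (eqVneq b (linv a)) => [_|ne].
  exact: path_sorted rw.
by rewrite /reduced /= ne.
Qed.

Lemma wcons_reduced a w : reduced (a :: w) -> wcons a w = a :: w.
Proof. by case: w => [|b w] //= /andP[/negPf ->]. Qed.

Lemma wconsK a w : reduced w -> wcons (linv a) (wcons a w) = w.
Proof.
case: w => [|b w] rw /=; first by rewrite linvK eqxx.
case: (eqVneq b (linv a)) => [e|ne] /=; last by rewrite linvK eqxx.
by rewrite -e wcons_reduced.
Qed.

Lemma reduced_wmul u v : reduced v -> reduced (wmul u v).
Proof. by move=> rv; elim: u => //= a u; apply: reduced_wcons. Qed.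

Lemma wmul_wcons a u w : reduced w -> wmul (wcons a u) w = wcons a (wmul u w).
Proof.
case: u => [|b u] //= rw; case: (eqVneq b (linv a)) => [->|_] //=.
by rewrite -{1}(linvK a) wconsK // reduced_wmul.
Qed.

Lemma wmulA u v w : reduced w -> wmul u (wmul v w) = wmul (wmul u v) w.
Proof. by move=> rw; elim: u => //= a u ->; rewrite wmul_wcons. Qed.

Lemma wmulw0 u : reduced u -> wmul u [::] = u.
Proof.
elim: u => //= a u IH ru; rewrite IH ?wcons_reduced //.
exact: path_sorted ru.
Qed.

Lemma winvP u w : reduced w -> wmul (winv u) (wmul u w) = w.
Proof.
elim: u w => // a u IH w rw.
rewrite /winv /= rev_cons -cats1 /wmul foldr_cat /= wconsK; first exact: IH.
exact: reduced_wmul.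
Qed.

Lemma winvK : involutive winv.
Proof. by move=> u; rewrite /winv map_rev revK (mapK linvK). Qed.

Lemma reduced_winv u : reduced u -> reduced (winv u).
Proof.
rewrite /reduced /winv rev_sorted sorted_map; apply: sub_sorted => a b /=.
by apply: contraNneq => /(can_inj linvK) ->; rewrite linvK.
Qed.

Implicit Types x y : free_group.

Fact fgM_subproof x y : reduced (wmul x y).
Proof. exact/reduced_wmul/valP. Qed.
Fact fgV_subproof x : reduced (winv x).
Proof. exact/reduced_winv/valP. Qed.

Definition fg1 : free_group := @FreeGroup [::] isT.
Definition fgM x y : free_group := FreeGroup (fgM_subproof x y).
Definition fgV x : free_group := FreeGroup (fgV_subproof x).

Fact fgMA : associative fgM.
Proof. by move=> x y z; apply: val_inj; apply/wmulA/valP. Qed.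
Fact fg1M : left_id fg1 fgM.
Proof. by move=> x; apply: val_inj. Qed.
Fact fgM1 : right_id fg1 fgM.
Proof. by move=> x; apply: val_inj; apply/wmulw0/valP. Qed.
Fact fgVM : left_inverse fg1 fgV fgM.
Proof.
move=> x; apply: val_inj => /=.
by rewrite -{2}(wmulw0 (valP x)) winvP.
Qed.
Fact fgMV : right_inverse fg1 fgV fgM.
Proof.
move=> x; rewrite -(fgVM (fgV x)); congr fgM.
by apply: val_inj; rewrite /= winvK.
Qed.

HB.instance Definition _ := isGroup.Build free_group fgMA fg1M fgM1 fgVM fgMV.

Definition fgletter a : free_group := @FreeGroup [:: a] isT.
Definition fgen (i : I) : free_group := fgletter (i, true).

Lemma fgletterV a : fgletter (linv a) = (fgletter a)^-1%g.
Proof. exact: val_inj. Qed.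

(* Fox calculus: on words, d(x_i^e w)/dx_j = d(x_i^e)/dx_j + x_i^e dw/dx_j,
   with dx_i/dx_j = delta_ij and d(x_i^-1)/dx_j = - delta_ij x_i^-1; see foxM
   and fox_gen below. *)
Definition fox_letter (j : I) a : group_ring int free_group :=
  if a.1 != j then 0
  else if a.2 then 1 else - grelt 1 (fgletter a).

Fixpoint fox_word (j : I) w : group_ring int free_group :=
  if w is a :: w' then fox_letter j a + grelt 1 (fgletter a) * fox_word j w'
  else 0.

Definition fox (j : I) x : group_ring int free_group := fox_word j x.

Lemma fox_letterV j a :
  fox_letter j (linv a) + grelt 1 (fgletter (linv a)) * fox_letter j a = 0.
Proof.
have key : grelt 1 (fgletter (linv a)) * grelt 1 (fgletter a) =
    1 :> group_ring int free_group.
  by rewrite grelt_mul fgletterV mulVg mulr1.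
case: a key => i [] /= key; rewrite /fox_letter /=; case: eqP => _ /=;
  by rewrite ?(mulr0, addr0) // ?mulr1 ?addNr // mulrN key subrr.
Qed.

Lemma fox_wcons j a w :
  fox_word j (wcons a w) = fox_letter j a + grelt 1 (fgletter a) * fox_word j w.
Proof.
case: w => [|b w] //=; case: (eqVneq b (linv a)) => //= ->.
have := fox_letterV j (linv a); rewrite linvK => e.
by rewrite mulrDr addrA e add0r mulrA grelt_mul fgletterV mulgV mulr1 mul1r.
Qed.

Lemma fgletter_cons a w (h : reduced (a :: w)) (h' : reduced w) :
  FreeGroup h = (fgletter a * FreeGroup h')%g.
Proof. by apply: val_inj; rewrite /= wcons_reduced. Qed.

Lemma foxM j x y : fox j (x * y)%g = fox j x + grelt 1 x * fox j y.
Proof.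
rewrite /fox /=; case: x => /= w.
elim: w => [|a w IH] h /=; first by rewrite add0r (_ : grelt _ _ = 1) ?mul1r //; congr grelt; apply: val_inj.
have h' : reduced w by apply: path_sorted h.
have e : grelt 1 (FreeGroup h) =
    grelt 1 (fgletter a) * grelt 1 (FreeGroup h') :> group_ring int free_group.
  by rewrite grelt_mul mulr1 (fgletter_cons h h').
by rewrite fox_wcons (IH h') e mulrDr addrA -mulrA.
Qed.

Lemma fox_gen j i : fox j (fgen i) = (i == j)%:R.
Proof. by rewrite /fox /= mulr0 addr0 /fox_letter /=; case: eqP. Qed.

End FreeGroup.

(* the smallest normal subgroup containing S *)
Definition normal_closure (G : groupType) (S : G -> Prop) (g : G) : Prop :=
  forall K : G -> Prop,
    K 1%g -> (forall x y, K x -> K y -> K (x * y)%g) ->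
    (forall x, K x -> K x^-1%g) -> (forall x y, K x -> K (x ^ y)%g) ->
    (forall x, S x -> K x) -> K g.

(* pi presents G by the generators pi x_i (i < p) and the relators r_k (k < m) *)
Definition is_presentation (G : groupType) (p m : nat)
    (pi : {ghom free_group 'I_p -> G})
    (r : 'I_m -> free_group 'I_p) : Prop :=
  (forall g, exists w, pi w = g) /\
  (forall w, pi w = 1%g <-> normal_closure (fun u => exists k, u = r k) w).

Definition finitely_presented (G : groupType) : Prop :=
  exists (p m : nat) (pi : {ghom free_group 'I_p -> G})
         (r : 'I_m -> free_group 'I_p), is_presentation pi r.

(* Augmented group systems with d = 1; the distinguished conjugacy class is
   given by a representative. *)
Record aug_group_system := AugGroupSystem {
  ags_group :> groupType;
  ags_fp : finitely_presented ags_group;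
  ags_eps : {ghom ags_group -> Zt};
  ags_epi : forall k, exists g, ags_eps g = k;
  ags_elt : ags_group;
  ags_elt_nontrivial : ags_eps ags_elt <> 1%g
}.

(* the kernel of f is isomorphic to the free group on n generators *)
Definition kernel_free_of_rank (G H : groupType) (f : {ghom G -> H})
    (n : nat) : Prop :=
  exists b : {ghom free_group 'I_n -> G},
    injective b /\ (forall g, f g = 1%g <-> exists w, b w = g).

Lemma mulmx_intz (S : comNzRingType) (k : nat) (U V : 'M[S]_k) (c d : int) :
  (U *~ c) *m (V *~ d) = (U *m V) *~ (c * d).
Proof.
by rewrite -!scaler_int -scalemxAl -scalemxAr scalerA -intrM.
Qed.

Section AlexanderLin.
Variables (R : comUnitRingType) (A : aug_group_system) (N : nat).
Variable gamma : {ghom A -> GL R N}.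

Section Presentation.
Variables (p : nat) (pi : {ghom free_group 'I_p -> A}).

Definition Phi_elt (w : free_group 'I_p) : 'M[laurent R]_N :=
  lmon R (ags_eps A (pi w)) *: map_mx (@lconst R) (gamma (pi w)).

(* Z-linear extension of Phi_elt; by the lemmas below it is the ring
   homomorphism determined by x_i |-> eps(x_i) X_i. *)
Definition Phi (f : group_ring int (free_group 'I_p)) : 'M[laurent R]_N :=
  \sum_(w <- msupp f) Phi_elt w *~ f@_w.

Lemma Phi_grelt c w : Phi (grelt c w) = Phi_elt w *~ c.
Proof.
rewrite /Phi (big_fset_incl _ (msuppU_le (x := c) (k := w))) /=.
  by rewrite big_seq_fset1 mcoeffUU.
by move=> x _ /mcoeff_outdom ->; rewrite mulr0z.
Qed.

Lemma Phi_gen i :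
  Phi (grelt 1 (fgen i)) =
  lmon R (ags_eps A (pi (fgen i))) *: map_mx (@lconst R) (gamma (pi (fgen i))).
Proof. by rewrite Phi_grelt. Qed.

Lemma PhiD : {morph Phi : f g / f + g}.
Proof.
have wide (d : {fset free_group 'I_p}) f : (msupp f `<=` d)%fset ->
    Phi f = \sum_(w <- d) Phi_elt w *~ f@_w.
  move=> le; rewrite /Phi (big_fset_incl _ le) //= => w _ /mcoeff_outdom ->.
  by rewrite mulr0z.
move=> f g; rewrite [in RHS](wide _ _ (fsubsetUl _ (msupp g))).
rewrite [in RHS](wide _ _ (fsubsetUr (msupp f) _)) (wide _ _ (gr_suppD _ _)).
by rewrite -big_split; apply: eq_bigr => w _; rewrite gr_coefD mulrzDr.
Qed.

Lemma Phi_elt1 : Phi_elt 1%g = 1%:M.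
Proof.
have lmon1 : lmon R 1%g = 1 by [].
rewrite /Phi_elt !gmulf1 /= lmon1 scale1r.
apply/matrixP=> i j; rewrite !mxE.
by case: (i == j); rewrite ?mulr1n ?mulr0n // /lconst grelt0.
Qed.

Lemma Phi_eltM : {morph Phi_elt : u v / (u * v)%g >-> u *m v}.
Proof.
move=> u v; rewrite /Phi_elt !gmulfM -scalemxAl -scalemxAr scalerA.
rewrite [lmon R _ * _]grelt_mul mulr1; congr (_ *: _).
apply/matrixP=> i j; rewrite !mxE /lconst.
rewrite (big_morph (fun c : R => grelt c (1%g : Zt)) (greltD _) (grelt0 _ _)).
by apply: eq_bigr => k _; rewrite !mxE grelt_mul mulg1.
Qed.

Lemma Phi1 : Phi 1 = 1%:M.
Proof. by rewrite [LHS]Phi_grelt Phi_elt1. Qed.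

Lemma PhiM : {morph Phi : f g / f * g >-> f *m g}.
Proof.
have Phi0 : Phi 0 = 0 by rewrite /Phi msupp0 big_seq_fset0.
move=> f g; elim/gr_ind: f => [|f1 f2 e1 e2|c u].
- by rewrite mul0r Phi0 mul0mx.
- by rewrite mulrDl !PhiD mulmxDl e1 e2.
elim/gr_ind: g => [|g1 g2 e1 e2|d v].
- by rewrite mulr0 Phi0 mulmx0.
- by rewrite mulrDr !PhiD mulmxDr e1 e2.
by rewrite grelt_mul !Phi_grelt Phi_eltM mulmx_intz.
Qed.

End Presentation.

(* The generators are x_0, ..., x_q, and the column of x_0 is omitted. *)
Definition alexander_matrix (q m : nat)
    (pi : {ghom free_group 'I_q.+1 -> A})
    (r : 'I_m -> free_group 'I_q.+1) :
    'M[laurent R]_(\sum_(i < m) N, \sum_(j < q) N) :=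
  \mxblock_(i < m, j < q) (Phi pi (fox (lift ord0 j) (r i)) : 'M_(N, N)).

Definition maximal_minor (k l : nat) (M : 'M[laurent R]_(k, l))
    (a : laurent R) : Prop :=
  exists2 s : 'I_l -> 'I_k,
    {homo s : i j / (i < j)%N} & a = \det (rowsub s M).

(* D represents D_gamma(A), which is only defined up to units *)
Definition is_alexander_lin (D : laurent R) : Prop :=
  exists (q m : nat) (pi : {ghom free_group 'I_q.+1 -> A})
         (r : 'I_m -> free_group 'I_q.+1),
    [/\ is_presentation pi r, pi (fgen ord0) = ags_elt A, (q <= m)%N
      & is_gcd (maximal_minor (alexander_matrix pi r)) D].

End AlexanderLin.

(* Main.v *)
Require Import Defs.
From mathcomp Require Import all_boot all_order all_algebra.
From mathcomp Require Import finmap fingroup perm zify.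
From mathcomp.multinomials Require Import monalg.
From HB Require Import structures.

Set Implicit Arguments.
Unset Strict Implicit.
Unset Printing Implicit Defensive.

Import Order.TTheory GRing.Theory Num.Theory.
Local Open Scope ring_scope.

(** Let [L] be the ring of Laurent polynomials and let [rho] be the
    representation [g |-> t ^ eps g * gamma g].  The rows of the Alexander
    matrix of a presentation are relations between [q] blocks of [N] symbols,
    the Fox derivatives, and the [L]-module they present depends on the group
    alone: it carries the universal derivation [d], with
    [d (g h) = d g + rho g (d h)], that vanishes on [x]
    ([alexander_universal]).  All computations in that module are done with
    row vectors modulo the row span of a matrix, so no quotient module is
    formed.

    The kernel of [eps] is free on [a_1, ..., a_n], so the group is the
    semidirect product of it with the infinite cyclic group generated by [x],
    and the square matrix [M0] of the relations [x a_j x^-1 = phi_j] carries a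
    universal derivation as well ([conj_matrix_universal]).  Freeness of the
    kernel enters here: a Fox derivative of a word in the [a_j] is a function
    of the group element.

    Two matrices that carry universal derivations present the same module, and
    thus have the same ideal of maximal minors.  For the square matrix [M0]
    this ideal is generated by [\det M0], which is therefore associated to
    the greatest common divisor of the maximal minors of any other
    presentation ([ud_square_divides]).

    Finally [M0 = t P - J], where [P] is block diagonal with blocks
    [gamma x] and [J] is the Fox Jacobian of the automorphism [a_j |-> phi_j];
    both are invertible over [R], the latter by the chain rule
    ([monodromy_mx_linv]).  Hence [\det M0] is a unit times the characteristic
    polynomial of [P^-1 J], which is monic of degree [n N] with constant
    coefficient [\pm \det (P^-1 J)] ([det_conj_matrix]).  Multiplicativity of
    the extremal coefficients transfers this to every associate
    ([extremal_associated]). *)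

(** * Ideals of maximal minors *)

Section CommonDivisor.
Variables (S : comNzRingType) (e : S).

Lemma dividesD a b : divides e a -> divides e b -> divides e (a + b).
Proof. by case=> c -> [d ->]; exists (c + d); rewrite mulrDl. Qed.

Lemma dividesMl c a : divides e a -> divides e (c * a).
Proof. by case=> d ->; exists (c * d); rewrite mulrA. Qed.

Lemma divides_sum (I : finType) (F : I -> S) :
  (forall i, divides e (F i)) -> divides e (\sum_i F i).
Proof.
move=> eF; elim/big_ind: _ => [|a b|i _] //; first by exists 0; rewrite mul0r.
exact: dividesD.
Qed.

Variables (k l : nat) (M : 'M[S]_(k, l)).
Hypothesis eM : forall s : 'I_l -> 'I_k,
  {homo s : i j / (i < j)%N} -> divides e (\det (rowsub s M)).

(** A selection of rows in arbitrary order gives a minor up to sign, or zero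
    when a row is repeated. *)
Lemma divides_minor (f : 'I_l -> 'I_k) : divides e (\det (rowsub f M)).
Proof.
case: (boolP (injectiveb f)) => [/injectiveP injf|]; last first.
  case/injectivePn=> i [j ne eqf]; exists 0; rewrite mul0r.
  by apply: (determinant_alternate ne) => x; rewrite !mxE eqf.
have cardf : #|f @: 'I_l| = l by rewrite card_imset // card_ord.
pose s (i : 'I_l) : 'I_k := enum_val (cast_ord (esym cardf) i).
have s_incr : {homo s : i j / (i < j)%N}.
  move=> i j lt_ij; rewrite /s /enum_val.
  set z := enum_default _; set z' := enum_default _.
  have srt : sorted ltn (map val (enum (f @: 'I_l))).
    apply: (subseq_sorted ltn_trans _ (iota_ltn_sorted 0 k)).
    by rewrite -val_enum_ord map_subseq // enumT filter_subseq.
  have sz : size (enum (f @: 'I_l)) = l by rewrite -cardE.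
  rewrite -!(nth_map _ 0%N val) ?sz //;
    [|exact: (ltn_ord j)|exact: (ltn_ord i)].
  apply: (sorted_ltn_nth ltn_trans 0%N srt) => //; rewrite inE size_map sz.
    exact: (ltn_ord i).
  exact: (ltn_ord j).
have fs i : f i \in f @: 'I_l by apply: imset_f.
pose g i : 'I_l := cast_ord cardf (enum_rank_in (fs i) (f i)).
have sg i : s (g i) = f i by rewrite /s /g cast_ordK enum_rankK_in.
have injg : injective g by move=> i j /(congr1 s); rewrite !sg => /injf.
have -> : rowsub f M = row_perm (perm injg) (rowsub s M).
  by apply/matrixP=> i j; rewrite !mxE permE sg.
by rewrite row_permE det_mulmx; apply: dividesMl; apply: eM.
Qed.

(** Expanding the determinant along the rows of the product is the
    Cauchy-Binet formula before the terms are grouped. *)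
Lemma divides_det_mulmx (P : 'M[S]_(l, k)) : divides e (\det (P *m M)).
Proof.
rewrite /determinant.
under eq_bigr => s _.
  under eq_bigr => i _ do rewrite mxE.
  rewrite bigA_distr_bigA /= mulr_sumr.
  over.
rewrite exchange_big /=; apply: divides_sum => f.
rewrite (_ : \sum_(_ | _) _ = (\prod_i P i (f i)) * \det (rowsub f M)).
  exact/dividesMl/divides_minor.
rewrite mulr_sumr; apply: eq_bigr => s _.
rewrite big_split /= mulrCA; congr (_ * (_ * _)).
by apply: eq_bigr => i _; rewrite !mxE.
Qed.

End CommonDivisor.

(** A minor of [P *m M] bordered by further columns still lies in the ideal of
    maximal minors of [M]: Laplace expansion along the first column of [Q]
    reduces the number of these columns by one. *)
Lemma divides_det_row_mx (S : comNzRingType) (e : S) (k r : nat)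
    (M : 'M[S]_(k, r)) :
  (forall s : 'I_r -> 'I_k,
     {homo s : i j / (i < j)%N} -> divides e (\det (rowsub s M))) ->
  forall (l : nat) (Q : 'M[S]_(l + r, l)) (P : 'M[S]_(l + r, k)),
    divides e (\det (row_mx Q (P *m M))).
Proof.
move=> eM; elim=> [|l IH] Q P.
  rewrite (_ : row_mx Q (P *m M) = P *m M); first exact: divides_det_mulmx.
  apply/matrixP=> i j; rewrite !mxE; case: splitP => [[] //|j' /= ejj'].
  by rewrite mxE; apply: eq_bigr => x _; congr (_ * M x _); apply: val_inj.
rewrite (expand_det_col _ (lshift r (ord0 : 'I_l.+1))).
apply: divides_sum => i; apply: dividesMl; rewrite /cofactor; apply: dividesMl.
rewrite (_ : row' i _ = row_mx (row' i (col' ord0 Q) : 'M_(l + r, l))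
                               ((row' i P : 'M_(l + r, k)) *m M)).
  exact: IH.
apply/matrixP=> a b; rewrite !mxE.
case: (splitP b) => [b' eb|b' eb]; rewrite !mxE.
  case: splitP => [c ec|c ec]; last first.
    by move: ec (ltn_ord b') => /=; rewrite /bump /= eb add1n addSn => -[->];
      rewrite ltnNge leq_addr.
  by congr (Q _ _); apply: val_inj; rewrite /= -ec /= eb.
case: splitP => [c ec|c ec].
  by move: (ltn_ord c); rewrite -ec /= /bump /= eb add1n ltnS ltnNge leq_addr.
rewrite mxE; apply: eq_bigr => x _; congr (_ * M _ _); first by rewrite !mxE.
apply: val_inj => /=; move: ec; rewrite /= /bump /= eb add1n addSn.
by move=> [] /eqP; rewrite eqn_add2l => /eqP ->.
Qed.

Section Fitting.
Variables (S : comNzRingType) (m k l : nat).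
Variables (M : 'M[S]_(m, k)) (M0 : 'M[S]_l).
Variables (A : 'M[S]_(k, l)) (B : 'M[S]_(l, k)).
Variables (U : 'M[S]_(k, m)) (V : 'M[S]_l).

(** In [coker M] the generators of both sides together are presented by the
    rows of [[M, 0; - B, 1]] as well as by those of [[1, - A; 0, M0]]; hence
    the first matrix is a multiple of the second, and so is its maximal
    square part formed by [rowsub s M] and the rows [[- B, 1]], whose
    determinant is the minor. *)
Lemma det_divides_minor (T : 'M[S]_(m, l)) :
  M *m A = T *m M0 -> B *m A = 1%:M + V *m M0 ->
  forall s : 'I_k -> 'I_m, divides (\det M0) (\det (rowsub s M)).
Proof.
move=> MA BA s; set Ms := rowsub s M.
have MsA : Ms *m A = rowsub s T *m M0 by rewrite /Ms !mul_rowsub_mx MA.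
exists (\det (block_mx Ms (rowsub s T) (- B) (- V))).
have -> : \det M0 = \det (block_mx 1%:M (- A) 0 M0).
  by rewrite det_ublock det1 mul1r.
have -> : \det Ms = \det (block_mx Ms 0 (- B) 1%:M).
  by rewrite det_lblock det1 mulr1.
rewrite -det_mulmx mulmx_block !mulmx1 !mulmx0 !addr0 !mulmxN !mulNmx opprK.
by rewrite MsA BA addNr addrK.
Qed.

(** The same comparison in the other direction: [[M0, 0; - A, 1]] becomes,
    after multiplication by the unimodular matrix [[1, B; 0, 1]], a matrix
    whose second block column is a multiple of [M]. *)
Lemma divides_det_of_minors (W : 'M[S]_(l, m)) (e : S) :
  M0 *m B = W *m M -> A *m B = 1%:M + U *m M ->
  (forall s : 'I_k -> 'I_m,
     {homo s : i j / (i < j)%N} -> divides e (\det (rowsub s M))) ->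
  divides e (\det M0).
Proof.
move=> M0B AB eM.
suff -> : \det M0 = \det (row_mx (col_mx M0 (- A)) (col_mx W (- U) *m M)).
  exact: divides_det_row_mx.
have -> : row_mx (col_mx M0 (- A)) (col_mx W (- U) *m M) =
    block_mx M0 0 (- A) 1%:M *m block_mx 1%:M B 0 1%:M.
  rewrite mulmx_block !mulmx1 !mulmx0 !addr0 M0B mulNmx AB.
  by rewrite mul_col_mx mulNmx opprD addrAC addNr add0r -block_mxEh.
by rewrite det_mulmx det_lblock det_ublock !det1 !mulr1.
Qed.

End Fitting.

(** * Derivations modulo a row span *)

Section RowCongruence.
Variables (S : comNzRingType) (n : nat).

(** Equality in the cokernel of [M], taken one block of [n] rows at a time. *)
Definition eqrow (k l : nat) (M : 'M[S]_(k, l)) (v w : 'M[S]_(n, l)) : Prop :=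
  exists C, v - w = C *m M.

Variables (k l : nat) (M : 'M[S]_(k, l)).
Implicit Types v w : 'M[S]_(n, l).

Lemma eqrow_refl v : eqrow M v v.
Proof. by exists 0; rewrite subrr mul0mx. Qed.

Lemma eqrow_sym v w : eqrow M v w -> eqrow M w v.
Proof. by case=> C e; exists (- C); rewrite mulNmx -e opprB. Qed.

Lemma eqrow_trans w v u : eqrow M v w -> eqrow M w u -> eqrow M v u.
Proof.
by case=> C e [D f]; exists (C + D); rewrite mulmxDl -e -f addrA subrK.
Qed.

Lemma eqrowD v w v' w' :
  eqrow M v w -> eqrow M v' w' -> eqrow M (v + v') (w + w').
Proof.
by case=> C e [D f]; exists (C + D); rewrite mulmxDl -e -f opprD addrACA.
Qed.

Lemma eqrowMl (X : 'M[S]_n) v w : eqrow M v w -> eqrow M (X *m v) (X *m w).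
Proof. by case=> C e; exists (X *m C); rewrite -mulmxA -e mulmxBr. Qed.

Lemma eqrowMl0 (X : 'M[S]_n) v : eqrow M v 0 -> eqrow M (X *m v) 0.
Proof. by move/(eqrowMl X); rewrite mulmx0. Qed.

Lemma eqrowN0 v : eqrow M v 0 -> eqrow M (- v) 0.
Proof. by case=> C e; exists (- C); rewrite mulNmx -e !subr0. Qed.

Lemma eqrowDr0 v w : eqrow M w 0 -> eqrow M (v + w) v.
Proof. by move/(eqrowD (eqrow_refl v)); rewrite addr0. Qed.

Lemma eqrow_mul_id (X Y : 'M[S]_n) v w :
  Y *m X = 1%:M -> eqrow M (X *m v) (X *m w) -> eqrow M v w.
Proof. by move=> YX /(eqrowMl Y); rewrite !mulmxA YX !mul1mx. Qed.

Lemma eqrowMr (k' l' : nat) (M' : 'M[S]_(k', l')) A T v w :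
  M *m A = T *m M' -> eqrow M v w -> eqrow M' (v *m A) (w *m A).
Proof.
by move=> MA [C e]; exists (C *m T); rewrite -mulmxBl e -!mulmxA MA.
Qed.

End RowCongruence.

Lemma rowspan_mxcol (S : comNzRingType) (n m k l : nat)
    (X : 'M[S]_(\sum_(i < m) n, l)) (M : 'M[S]_(k, l)) :
  (forall i, eqrow M (submxcol X i) 0) -> exists T, X = T *m M.
Proof.
move=> h; have [C hC] := fin_all_exists h.
exists (\mxcol_i C i); rewrite mxcol_mul -[LHS]submxcolK.
by apply: eq_mxcol => i; rewrite -hC subr0.
Qed.

Section Derivation.
Variables (S : comNzRingType) (n : nat) (G : groupType) (sigma : G -> 'M[S]_n).

Definition derivation_mod (k l : nat) (M : 'M[S]_(k, l))
    (d : G -> 'M[S]_(n, l)) : Prop :=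
  forall u v, eqrow M (d (u * v)%g) (d u + sigma u *m d v).

Definition derivation (l : nat) (d : G -> 'M[S]_(n, l)) : Prop :=
  forall u v, d (u * v)%g = d u + sigma u *m d v.

Lemma derivation_modW (k l : nat) (M : 'M[S]_(k, l)) d :
  derivation d -> derivation_mod M d.
Proof. by move=> dM u v; rewrite dM; apply: eqrow_refl. Qed.

Lemma derivation_mulr (l l' : nat) (Y : 'M[S]_(l, l')) d :
  derivation d -> derivation (fun u => d u *m Y).
Proof. by move=> dM u v; rewrite dM mulmxDl mulmxA. Qed.

Hypothesis sigma1 : sigma 1%g = 1%:M.

Variables (k l : nat) (M : 'M[S]_(k, l)) (d : G -> 'M[S]_(n, l)).
Hypothesis dM : derivation_mod M d.

Lemma der_mod1 : eqrow M (d 1%g) 0.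
Proof.
have [C e] := dM 1%g 1%g; exists (- C).
by rewrite mulNmx -e mul1g sigma1 mul1mx opprB addrK subr0.
Qed.

Lemma der_modV u : eqrow M (d u^-1%g) (- (sigma u^-1%g *m d u)).
Proof.
have := eqrow_trans (eqrow_sym (dM u^-1%g u)); rewrite mulVg => /(_ _ der_mod1).
move=> /eqrowD /(_ (eqrow_refl M (- (sigma u^-1%g *m d u)))).
by rewrite addrK add0r.
Qed.

(** With [der_mod_agreeV] below: the elements on which two derivations agree
    form a subgroup. *)
Lemma der_mod_agreeM d' u v : derivation_mod M d' ->
  eqrow M (d u) (d' u) -> eqrow M (d v) (d' v) ->
  eqrow M (d (u * v)%g) (d' (u * v)%g).
Proof.
move=> dM' eu ev; apply: (eqrow_trans (dM u v)).
apply: eqrow_trans (eqrow_sym (dM' u v)).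
by apply: eqrowD => //; apply: eqrowMl.
Qed.

End Derivation.

Lemma derivation_mull (S : comNzRingType) (n : nat) (G : groupType)
    (sigma tau : G -> 'M[S]_n) (X : 'M[S]_n) (l : nat) (d : G -> 'M[S]_(n, l)) :
  (forall u, X *m sigma u = tau u *m X) -> derivation sigma d ->
  derivation tau (fun u => X *m d u).
Proof. by move=> Xs dM u v; rewrite dM mulmxDr !mulmxA Xs. Qed.

Lemma der_mod_agreeV (S : comNzRingType) (n : nat) (G : groupType)
    (sigma : G -> 'M[S]_n) (k l : nat) (M : 'M[S]_(k, l)) d d' u :
  sigma 1%g = 1%:M -> derivation_mod sigma M d -> derivation_mod sigma M d' ->
  eqrow M (d u) (d' u) -> eqrow M (d u^-1%g) (d' u^-1%g).
Proof.
move=> s1 dM dM' eu; apply: (eqrow_trans (der_modV s1 dM u)).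
apply: eqrow_trans (eqrow_sym (der_modV s1 dM' u)).
by rewrite -2!mulNmx; apply: eqrowMl.
Qed.

Lemma free_group_gen (I : choiceType) (K : free_group I -> Prop) :
  K 1%g -> (forall u v, K u -> K v -> K (u * v)%g) ->
  (forall u, K u -> K u^-1%g) -> (forall i, K (fgen i)) -> forall u, K u.
Proof.
move=> K1 KM KV Kg [w rw]; elim: w rw => [|a w IH] rw.
  by rewrite (_ : FreeGroup rw = 1%g) //; apply: val_inj.
have rw' : reduced w by apply: path_sorted rw.
rewrite (fgletter_cons rw rw'); apply: KM; last exact: IH.
case: a {rw} => i [] //; first exact: Kg.
by rewrite (_ : fgletter _ = (fgen i)^-1%g); [apply/KV/Kg|apply: val_inj].
Qed.

Lemma der_mod_free (S : comNzRingType) (n : nat) (I : choiceType)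
    (sigma : free_group I -> 'M[S]_n) (k l : nat) (M : 'M[S]_(k, l)) d d' :
  sigma 1%g = 1%:M -> derivation_mod sigma M d -> derivation_mod sigma M d' ->
  (forall i, eqrow M (d (fgen i)) (d' (fgen i))) ->
  forall u, eqrow M (d u) (d' u).
Proof.
move=> s1 dM dM' eg; apply: free_group_gen => //.
- apply: (eqrow_trans (der_mod1 s1 dM)); apply: eqrow_sym.
  exact: (der_mod1 s1 dM').
- by move=> u v; apply: (der_mod_agreeM dM dM').
- by move=> u; apply: (der_mod_agreeV s1 dM dM').
Qed.

Section Universal.
Variables (S : comNzRingType) (n : nat) (G : groupType).
Variables (rho : G -> 'M[S]_n) (x : G).

(** The derivation [d], with values in the cokernel of [M], is universal among
    the derivations that vanish on [x].  The generators of the cokernel must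
    be values of [d] ([ud_gen]); this makes the map induced on the cokernel by
    universality unique. *)
Record universal_der (k q : nat) (M : 'M[S]_(k, \sum_(j < q) n))
    (d : G -> 'M[S]_(n, \sum_(j < q) n)) : Prop := UniversalDer {
  udM : derivation_mod rho M d;
  ud_elt : eqrow M (d x) 0;
  ud_gen : forall j, exists g, eqrow M (d g) (submxcol 1%:M j);
  ud_univ : forall (k' l' : nat) (M' : 'M[S]_(k', l')) d',
    derivation_mod rho M' d' -> eqrow M' (d' x) 0 ->
    exists A T, M *m A = T *m M' /\ forall g, eqrow M' (d g *m A) (d' g)
}.

(** Going from one universal pair to another and back is the identity on the
    cokernel, because it fixes the values of [d], which generate. *)
Lemma ud_endo (k q k' q' : nat) (M : 'M_(k, \sum_(j < q) n)) d
    (M' : 'M_(k', \sum_(j < q') n)) d' A T B T' :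
  universal_der M d ->
  M *m A = T *m M' -> (forall g, eqrow M' (d g *m A) (d' g)) ->
  M' *m B = T' *m M -> (forall g, eqrow M (d' g *m B) (d g)) ->
  exists U, A *m B = 1%:M + U *m M.
Proof.
move=> ud MA dA MB dB.
suff [U e] : exists U, A *m B - 1%:M = U *m M.
  by exists U; rewrite -e addrC subrK.
apply: rowspan_mxcol => j; have [g eg] := ud_gen ud j.
have e2 : eqrow M (submxcol (A *m B) j) (submxcol 1%:M j).
  rewrite -[A *m B]mul1mx -submxcol_mul mulmxA.
  apply: eqrow_trans (eqrow_trans (dB g) eg).
  apply: (eqrowMr MB); apply: eqrow_trans (dA g).
  by apply: (eqrowMr MA); apply: eqrow_sym.
by case: e2 => C e2; exists C; rewrite submxcolB subr0.
Qed.

(** Equality of the ideals of maximal minors of two universal pairs, in the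
    form needed when one of the matrices is square. *)
Lemma ud_square_divides (k q q' : nat) (M : 'M_(k, \sum_(j < q) n)) d
    (M0 : 'M_(\sum_(j < q') n)) d0 :
  universal_der M d -> universal_der M0 d0 ->
  (forall s : 'I__ -> 'I_k, divides (\det M0) (\det (rowsub s M))) /\
  (forall e, (forall s : 'I__ -> 'I_k, {homo s : i j / (i < j)%N} ->
      divides e (\det (rowsub s M))) -> divides e (\det M0)).
Proof.
move=> ud ud0.
have [A [T [MA dA]]] := ud_univ ud (udM ud0) (ud_elt ud0).
have [B [W [MB dB]]] := ud_univ ud0 (udM ud) (ud_elt ud).
have [U AB] := ud_endo ud MA dA MB dB.
have [V BA] := ud_endo ud0 MB dB MA dA.
split=> [s|e]; first exact: (det_divides_minor MA BA).
exact: (divides_det_of_minors MB AB).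
Qed.

End Universal.

(** * The Alexander matrix carries the universal derivation *)

(** The choice operator of [W] picks a preimage for every element of a
    possibly infinite type at once. *)
Lemma section_exists (T : Type) (W : choiceType) (P : T -> W -> bool) :
  (forall t, exists w, P t w) -> exists s, forall t, P t (s t).
Proof. by move=> h; exists (fun t => xchoose (h t)) => t; apply: xchooseP. Qed.

Section FoxRows.
Variables (R : comUnitRingType) (A : aug_group_system) (N : nat).
Variable gamma : {ghom A -> GL R N}.

Definition twist (g : A) : 'M[laurent R]_N :=
  lmon R (ags_eps A g) *: map_mx (@lconst R) (gamma g).

Lemma twist1 : twist 1%g = 1%:M.
Proof.
have [p [m [pi _]]] := ags_fp A.
by rewrite -(Phi_elt1 gamma pi) /Phi_elt gmulf1.
Qed.

Lemma twistM g h : twist (g * h)%g = twist g *m twist h.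
Proof.
have [p [m [pi [r [surj _]]]]] := ags_fp A.
have [u <-] := surj g; have [v <-] := surj h.
by rewrite -gmulfM; apply: Phi_eltM.
Qed.

Lemma twistVK g : twist g^-1%g *m twist g = 1%:M.
Proof. by rewrite -twistM mulVg twist1. Qed.

Lemma twistKV g : twist g *m twist g^-1%g = 1%:M.
Proof. by rewrite -twistM mulgV twist1. Qed.

Lemma twist_conj x g : twist x *m twist g = twist (x * g * x^-1)%g *m twist x.
Proof.
apply: etrans (esym (twistM _ _)) (etrans _ (twistM _ _)).
by congr twist; rewrite mulgVK.
Qed.

Section Rows.
Variables (p q : nat) (pi : {ghom free_group 'I_p -> A}) (c : 'I_q -> 'I_p).
Hypothesis c_inj : injective c.

(** The injection [c] selects the generators with respect to which one
    differentiates. *)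
Definition foxrow (f : free_group 'I_p) : 'M[laurent R]_(N, \sum_(j < q) N) :=
  \mxrow_(j < q) (Phi gamma pi (fox (c j) f) : 'M_(N, N)).

Lemma foxrow_der : derivation (fun u => twist (pi u)) foxrow.
Proof.
move=> u v; rewrite /foxrow mul_mxrow -mxrowD; apply: eq_mxrow => j.
by rewrite foxM PhiD PhiM Phi_grelt.
Qed.

Lemma foxrow_mxcol (l : nat) (X : 'M_(_, l)) j :
  foxrow (fgen (c j)) *m X = submxcol X j.
Proof.
rewrite -{1}(submxcolK X) /foxrow mul_mxrow_mxcol (bigD1 j) //= big1.
  by rewrite fox_gen eqxx Phi1 mul1mx addr0.
move=> i ne; rewrite fox_gen (inj_eq c_inj) eq_sym (negPf ne).
by rewrite /Phi msupp0 big_seq_fset0 mul0mx.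
Qed.

Lemma foxrow_gen j : foxrow (fgen (c j)) = submxcol 1%:M j.
Proof. by rewrite -[LHS]mulmx1 foxrow_mxcol. Qed.

Lemma foxrow_gen0 i : (forall j, i != c j) -> foxrow (fgen i) = 0.
Proof.
move=> ic; rewrite /foxrow -[RHS]mxrow0; apply: eq_mxrow => j.
by rewrite fox_gen (negPf (ic j)) /Phi msupp0 big_seq_fset0.
Qed.

Lemma twist_pi1 : twist (pi 1%g) = 1%:M.
Proof. by rewrite gmulf1 twist1. Qed.

(** Chain rule: on words, a derivation of the group that vanishes on the
    generators left out by [c] is a linear function of the Fox row. *)
Lemma foxrow_univ (k l : nat) (M : 'M_(k, l)) (d : A -> 'M_(N, l)) :
  derivation_mod twist M d ->
  (forall i, (forall j, i != c j) -> eqrow M (d (pi (fgen i))) 0) ->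
  forall u, eqrow M (foxrow u *m (\mxcol_(j < q) d (pi (fgen (c j)))))
                    (d (pi u)).
Proof.
move=> dM d0; apply: (der_mod_free twist_pi1) => [|u v|i].
- exact/derivation_modW/derivation_mulr/foxrow_der.
- by rewrite gmulfM.
have [/existsP[j /eqP ->]|] := boolP [exists j, i == c j].
  by rewrite foxrow_mxcol mxcolK; apply: eqrow_refl.
rewrite negb_exists => /forallP ic; rewrite foxrow_gen0 // mul0mx.
by apply: eqrow_sym; apply: d0.
Qed.

End Rows.

Section Presented.
Variables (q m : nat) (pi : {ghom free_group 'I_q.+1 -> A}).
Variable r : 'I_m -> free_group 'I_q.+1.
Hypothesis pres : is_presentation pi r.
Hypothesis pi0 : pi (fgen ord0) = ags_elt A.

Local Notation M := (alexander_matrix gamma pi r).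
Local Notation row := (foxrow pi (@lift q.+1 ord0)).

Lemma submxcol_alexander k : submxcol M k = row (r k).
Proof. by rewrite /alexander_matrix mxblockEv mxcolK. Qed.

(** The words that are trivial in the group and have Fox row zero modulo [M]
    form a normal subgroup, which contains the relators. *)
Lemma foxrow_relator u : pi u = 1%g -> eqrow M (row u) 0.
Proof.
case: pres => _ ker; move=> /ker
  /(_ (fun u => pi u = 1%g /\ eqrow M (row u) 0)).
have tw1 : twist (pi 1%g) = 1%:M by rewrite gmulf1 twist1.
have rd := derivation_modW M (foxrow_der pi (@lift q.+1 ord0)).
have rowM x y : pi x = 1%g -> eqrow M (row x) 0 -> eqrow M (row y) 0 ->
    eqrow M (row (x * y)%g) 0.
  move=> px ex ey; apply: eqrow_trans (rd _ _) _.
  by rewrite px twist1 mul1mx -[0]addr0; apply: eqrowD.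
case.
- by split; [rewrite gmulf1|apply: (der_mod1 tw1 rd)].
- by move=> x y [px ex] [py ey]; rewrite gmulfM px py mulg1; split=> //;
    apply: rowM.
- move=> x [px ex]; rewrite gmulfV px invg1; split=> //.
  apply: eqrow_trans (der_modV tw1 rd x) _.
  exact/eqrowN0/eqrowMl0.
- move=> x y [px ex]; rewrite conjgE !gmulfM px mul1g gmulfV mulVg; split=> //.
  apply: eqrow_trans (rd _ _) _.
  have e : eqrow M (row (x * y)%g) (row y).
    apply: eqrow_trans (rd _ _) _.
    rewrite px twist1 mul1mx -[X in eqrow _ _ X]add0r.
    exact: (eqrowD ex (eqrow_refl _ _)).
  apply: eqrow_trans (eqrowD (eqrow_refl M _) (eqrowMl _ e)) _.
  apply: eqrow_trans (eqrow_sym (rd _ _)) _.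
  by rewrite mulVg; apply: (der_mod1 tw1 rd).
- move=> x [k ->]; split; first by apply/ker => K _ _ _ _; apply; exists k.
  by rewrite -submxcol_alexander; exists (submxcol 1%:M k);
    rewrite submxcol_mul mul1mx subr0.
by [].
Qed.

Lemma foxrow_congr u v : pi u = pi v -> eqrow M (row u) (row v).
Proof.
move=> e; rewrite -(mulKVg v u).
rewrite foxrow_der; apply/eqrowDr0/eqrowMl0/foxrow_relator.
by rewrite gmulfM gmulfV e mulVg.
Qed.

(** The cokernel of the Alexander matrix represents the functor of
    derivations of the group that vanish on the distinguished element. *)
Lemma alexander_universal : exists d, universal_der twist (ags_elt A) M d.
Proof.
have [s sP] : exists s, forall g, pi (s g) == g.
  apply: (section_exists (P := fun g w => pi w == g)) => g.
  by have [w <-] := pres.1 g; exists w.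
have {}sP g : pi (s g) = g by apply/eqP.
have rowM u g : pi u = g -> eqrow M (row (s g)) (row u).
  by move=> e; apply: foxrow_congr; rewrite sP e.
exists (fun g => row (s g)); split.
- move=> g h; apply: eqrow_trans (rowM (s g * s h)%g _ _) _.
    by rewrite gmulfM !sP.
  by rewrite foxrow_der sP; apply: eqrow_refl.
- apply: eqrow_trans (rowM _ _ pi0) _.
  by rewrite foxrow_gen0; [apply: eqrow_refl|move=> j; apply: neq_lift].
- move=> j; exists (pi (fgen (lift ord0 j))).
  apply: eqrow_trans (rowM _ _ erefl) _.
  by rewrite foxrow_gen; [apply: eqrow_refl|apply: lift_inj].
move=> k l M' d' dM' d0.
pose B := \mxcol_(j < q) d' (pi (fgen (lift ord0 j))).
have rowB u : eqrow M' (row u *m B) (d' (pi u)).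
  apply: foxrow_univ => //; first exact: lift_inj.
  move=> i; case: (unliftP ord0 i) => [j -> /(_ j)|->]; first by rewrite eqxx.
  by rewrite pi0.
suff [T e] : exists T, M *m B = T *m M'.
  by exists B, T; split=> // g; rewrite -{2}(sP g).
apply: rowspan_mxcol => i; rewrite -submxcol_mul submxcol_alexander.
apply: eqrow_trans (rowB _) _.
have -> : pi (r i) = 1%g by apply/(pres.2) => K _ _ _ _; apply; exists i.
exact: (der_mod1 twist1 dM').
Qed.

End Presented.
End FoxRows.

(** * Infinite cyclic extensions of free groups *)

Section IntegerPowers.
Variables (G : groupType) (x : G).

Definition zpow (k : int) : G :=
  match k with Posz n => (x ^+ n)%g | Negz n => (x ^- n.+1)%g end.

Lemma zpowS k : zpow (1 + k) = (x * zpow k)%g.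
Proof.
case: k => [k|[|k]]; first by rewrite -PoszD add1n /= expgS.
  by rewrite /= expg1 mulgV.
rewrite (_ : 1 + Negz k.+1 = Negz k).
  by rewrite /= [in RHS]expgSr invgM mulKVg.
by rewrite !NegzE -[k.+2]addn1 PoszD opprD addrCA subrr addr0.
Qed.

Lemma zpowD k l : zpow (k + l) = (zpow k * zpow l)%g.
Proof.
elim/int_rec: k => [|k IH|k IH]; first by rewrite add0r mul1g.
  by rewrite -add1n PoszD -addrA !zpowS IH mulgA.
apply: (mulgI x); rewrite mulgA -!zpowS addrA.
by rewrite -add1n PoszD opprD addrA subrr add0r.
Qed.

Lemma zpow_closed (K : G -> Prop) :
  K 1%g -> (forall g h, K g -> K h -> K (g * h)%g) ->
  (forall g, K g -> K g^-1%g) -> K x -> forall k, K (zpow k).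
Proof.
move=> K1 KM KV Kx.
have KX n : K (x ^+ n)%g by elim: n => // n IH; rewrite expgS; apply: KM.
by case=> n /=; [|apply: KV].
Qed.

End IntegerPowers.

Section FreeByCyclic.
Variables (R : comUnitRingType) (A : aug_group_system) (N : nat).
Variable gamma : {ghom A -> GL R N}.
Hypothesis heps : ags_eps A (ags_elt A) = tgen.
Variables (n : nat) (b : {ghom free_group 'I_n -> A}).
Hypothesis b_inj : injective b.
Hypothesis ker_b : forall g, ags_eps A g = 1%g <-> exists w, b w = g.

Local Notation x := (ags_elt A).
Local Notation eps := (ags_eps A).
Local Notation rho := (twist gamma).
Local Notation row := (foxrow gamma b (@id 'I_n)).

Lemma eps_b w : eps (b w) = 1%g.
Proof. by apply/ker_b; exists w. Qed.

Lemma eps_zpow k : eps (zpow x k) = k.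
Proof.
have nat_case m : eps (x ^+ m)%g = m%:Z.
  elim: m => [|m IH]; first by rewrite expg0 gmulf1.
  by rewrite expgS gmulfM IH heps -add1n PoszD.
by case: k => m /=; rewrite ?gmulfV nat_case ?NegzE.
Qed.

Lemma ker_section : exists s, forall g, eps g = 1%g -> b (s g) = g.
Proof.
have [s sP] : exists s, forall g, (eps g == 1%g) ==> (b (s g) == g).
  apply: (section_exists (P := fun g w => (eps g == 1%g) ==> (b w == g))) => g.
  case: eqP => [/ker_b[w <-]|_]; first by exists w; rewrite eqxx.
  by exists 1%g.
by exists s => g /eqP e; apply/eqP; move: (sP g); rewrite e.
Qed.

Lemma eps_conj g w : eps (g * b w * g^-1)%g = 1%g.
Proof. by rewrite !gmulfM eps_b mulg1 gmulfV mulgV. Qed.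

Lemma inner_lift g : exists2 Psi : free_group 'I_n -> free_group 'I_n,
  forall w, b (Psi w) = (g * b w * g^-1)%g & {morph Psi : u w / (u * w)%g}.
Proof.
have [s sP] := ker_section; exists (fun w => s (g * b w * g^-1)%g).
  by move=> w; apply/sP/eps_conj.
move=> u w; apply: b_inj; rewrite [RHS]gmulfM !sP ?eps_conj // gmulfM.
by rewrite !mulgA mulgVK.
Qed.

(** The Alexander matrix of the presentation of the group by [x] and the [a_j],
    with the relators [x a_j x^-1 (phi j)^-1] and the column of [x] omitted. *)
Definition conj_matrix (phi : 'I_n -> free_group 'I_n) :
    'M[laurent R]_(\sum_(j < n) N) :=
  \mxcol_(j < n) (rho x *m submxcol 1%:M j - row (phi j)).

Variable phi : 'I_n -> free_group 'I_n.
Hypothesis phiP : forall j, b (phi j) = (x * b (fgen j) * x^-1)%g.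

Local Notation M := (conj_matrix phi).

Lemma foxrow_id_gen j : row (fgen j) = submxcol 1%:M j.
Proof. exact: (foxrow_gen gamma b (c := id)). Qed.

Lemma twist_b1 : rho (b 1%g) = 1%:M.
Proof. by rewrite gmulf1 twist1. Qed.

(** Modulo [M], conjugation by [x] acts on Fox rows as multiplication by
    [rho x]: both sides are derivations in [v], and on the generators the
    congruence is the definition of [M]. *)
Lemma foxrow_conj_x v v' :
  b v' = (x * b v * x^-1)%g -> eqrow M (row v') (rho x *m row v).
Proof.
have [Psi PsiP PsiM] := inner_lift x.
move=> e; rewrite (_ : v' = Psi v); last by apply: b_inj; rewrite PsiP.
move: v {v' e}; apply: (der_mod_free (sigma := fun w => rho (b (Psi w)))).
- by rewrite PsiP gmulf1 mulg1 mulgV twist1.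
- by apply: derivation_modW => u w; rewrite PsiM foxrow_der.
- apply/derivation_modW/derivation_mull/foxrow_der => u.
  by rewrite PsiP; apply: twist_conj.
move=> j; rewrite (_ : Psi (fgen j) = phi j); last first.
  by apply: b_inj; rewrite PsiP phiP.
apply: eqrow_sym; rewrite foxrow_id_gen; exists (submxcol 1%:M j).
by rewrite submxcol_mul mul1mx mxcolK.
Qed.

Lemma foxrow_conj k v v' :
  b v' = (zpow x k * b v * (zpow x k)^-1)%g ->
  eqrow M (row v') (rho (zpow x k) *m row v).
Proof.
move: v v'; apply: (zpow_closed (K := fun g => forall v v',
  b v' = (g * b v * g^-1)%g -> eqrow M (row v') (rho g *m row v))).
- move=> v v'; rewrite mul1g invg1 mulg1 twist1 mul1mx => /b_inj ->.
  exact: eqrow_refl.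
- move=> g h Kg Kh v v' e; have [s sP] := ker_section.
  have e1 := sP _ (eps_conj h v).
  rewrite twistM -mulmxA; apply: eqrow_trans (eqrowMl _ (Kh _ _ e1)).
  by apply: Kg; rewrite e e1 invgM !mulgA.
- move=> g Kg v v' e; apply: (eqrow_mul_id (twistVK gamma g)).
  rewrite mulmxA twistKV mul1mx; apply: eqrow_sym; apply: Kg.
  by rewrite e invgK !mulgA mulgV mul1g mulgK.
- exact: foxrow_conj_x.
Qed.

(** The universal derivation takes [g] to the Fox row of the element
    [g x^-(eps g)] of the free kernel; the derivation rule for it reduces to
    the effect of conjugation by powers of [x] on Fox rows. *)
Lemma conj_matrix_universal : exists d, universal_der rho x M d.
Proof.
have [s sP] := ker_section.
pose u g := s (g * zpow x (- (eps g : int)))%g.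
have uP g : b (u g) = (g * zpow x (- (eps g : int)))%g.
  by apply: sP; rewrite gmulfM eps_zpow; apply: subrr.
exists (fun g => row (u g)); split.
- move=> g h; pose k : int := eps g.
  have [v' v'P] : exists v', b v' = (zpow x k * b (u h) * (zpow x k)^-1)%g.
    by exists (s (zpow x k * b (u h) * (zpow x k)^-1)%g); apply/sP/eps_conj.
  have zV l : (zpow x l)^-1%g = zpow x (- l).
    by apply: (mulgI (zpow x l)); rewrite mulgV -zpowD subrr.
  have -> : u (g * h)%g = (u g * v')%g.
    have e : zpow x (- (eps (g * h)%g : int)) =
        (zpow x (- (eps h : int)) * zpow x (- k))%g.
      rewrite -zpowD gmulfM; congr zpow.
      exact: etrans (opprD k (eps h)) (addrC _ _).
    by apply: b_inj; rewrite gmulfM v'P !uP e -!zV !mulgA mulgVK.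
  rewrite foxrow_der; apply: eqrowD; first exact: eqrow_refl.
  have -> : rho g = rho (b (u g)) *m rho (zpow x k).
    by rewrite -twistM uP -mulgA -zpowD addNr mulg1.
  by rewrite -mulmxA; apply/eqrowMl/foxrow_conj.
- rewrite (_ : u x = 1%g).
    by apply: (der_mod1 twist_b1 (derivation_modW _ (foxrow_der gamma b id))).
  by apply: b_inj; rewrite uP heps gmulf1 /= expg1 mulgV.
- move=> j; exists (b (fgen j)); rewrite (_ : u _ = fgen j).
    by rewrite foxrow_id_gen; apply: eqrow_refl.
  by apply: b_inj; rewrite uP eps_b mulg1.
move=> k l M' d dM dx.
have rho1 := twist1 gamma.
have dr g h : eqrow M' (d h) 0 -> eqrow M' (d (g * h)%g) (d g).
  by move=> eh; apply: eqrow_trans (dM g h) _; apply/eqrowDr0/eqrowMl0.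
have dV g : eqrow M' (d g) 0 -> eqrow M' (d g^-1%g) 0.
  move=> eg; apply: eqrow_trans (der_modV rho1 dM g) _.
  exact/eqrowN0/eqrowMl0.
have dz i : eqrow M' (d (zpow x i)) 0.
  apply: (zpow_closed (K := fun g => eqrow M' (d g) 0) _ _ dV dx).
    exact: (der_mod1 rho1 dM).
  by move=> g h eg eh; apply: eqrow_trans (dr g h eh) eg.
pose B := \mxcol_(j < n) d (b (fgen j)).
have rowB w : eqrow M' (row w *m B) (d (b w)).
  by apply: foxrow_univ => // i /(_ i); rewrite eqxx.
suff [T e] : exists T, M *m B = T *m M'.
  exists B, T; split=> // g; apply: eqrow_trans (rowB _) _.
  by rewrite uP; apply/dr/dz.
apply: rowspan_mxcol => j; rewrite -submxcol_mul mxcolK mulmxBl.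
rewrite -mulmxA submxcol_mul mul1mx mxcolK.
have [C e] : eqrow M' (row (phi j) *m B) (rho x *m d (b (fgen j))).
  apply: eqrow_trans (rowB _) _; rewrite phiP.
  apply: eqrow_trans (dr _ _ (dV _ dx)) _; apply: eqrow_trans (dM _ _) _.
  rewrite -[X in eqrow _ _ X]add0r.
  exact: (eqrowD dx (eqrow_refl _ _)).
by exists (- C); rewrite subr0 mulNmx -e opprB.
Qed.

End FreeByCyclic.

(** * Extremal coefficients of Laurent polynomials *)

Section LaurentExtremes.
Variable R : idomainType.
Implicit Types f g : laurent R.

Definition extremal f (lo hi : int) : Prop :=
  [/\ mcoeff (lo : Zt) f != 0, mcoeff (hi : Zt) f != 0
    & forall k : int, mcoeff (k : Zt) f != 0 -> lo <= k <= hi].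

Lemma mem_lexps f (k : int) : (k \in lexps f) = (mcoeff (k : Zt) f != 0).
Proof. by rewrite /lexps mem_sort mcoeff_neq0. Qed.

Lemma extremal_exps f : f != 0 -> extremal f (lowexp f) (highexp f).
Proof.
move=> f0.
have : sorted <=%R (lexps f) by apply: sort_le_sorted.
have mem := mem_lexps f.
have : lexps f != [::].
  apply: contraNneq f0 => e; apply/eqP/malgP => k; apply/eqP.
  by rewrite mcoeff0; apply: negbNE; rewrite -[_ != _]mem e.
rewrite /extremal /lowexp /highexp; move: mem.
case: (lexps f) => //= k s mem _ srt; split.
- by rewrite -mem inE eqxx.
- by rewrite -mem mem_last.
move=> l; rewrite -mem => ls; apply/andP; split.
  move: ls; rewrite inE => /predU1P[->//|]; move: l.
  exact/allP/(order_path_min le_trans).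
have [i lti <-] := nthP 0 ls.
rewrite (last_nth 0).
apply: (sorted_leq_nth le_trans le_refl 0 (srt : sorted _ (k :: s))) => //.
by rewrite inE.
Qed.

Lemma extremal_eq f lo hi : extremal f lo hi ->
  lowexp f = lo /\ highexp f = hi.
Proof.
case=> flo fhi bnd.
have f0 : f != 0 by apply: contraNneq flo => ->; rewrite mcoeff0.
have [elo ehi ebnd] := extremal_exps f0.
have /andP[l1 _] := ebnd _ flo; have /andP[_ h1] := ebnd _ fhi.
have /andP[l2 _] := bnd _ elo; have /andP[_ h2] := bnd _ ehi.
by split; apply/eqP; rewrite eq_le ?l1 ?l2 ?h1 ?h2.
Qed.

Lemma laurent_coefM f g (z : int) :
  mcoeff (z : Zt) (f * g) =
  \sum_(x <- msupp f) \sum_(y <- msupp g)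
    (mcoeff x f * mcoeff y g) *+ ((x : int) + (y : int) == z).
Proof.
rewrite [f * g]grmul_def (raddf_sum (mcoeff (z : Zt))); apply: eq_bigr => x _.
rewrite (raddf_sum (mcoeff (z : Zt))); apply: eq_bigr => y _.
exact: mcoeffU.
Qed.

Lemma laurent_coefM_uniq f g (x y : int) :
  (forall a b : int, mcoeff (a : Zt) f != 0 -> mcoeff (b : Zt) g != 0 ->
     a + b = x + y -> a = x /\ b = y) ->
  mcoeff (x + y : Zt) (f * g) = mcoeff (x : Zt) f * mcoeff (y : Zt) g.
Proof.
move=> uniq_xy; rewrite laurent_coefM.
rewrite (eq_big_seq (fun a : Zt => (mcoeff a f * mcoeff (y : Zt) g)
    *+ (a == (x : Zt)))) => [|a fa]; last first.
  have [xa|xa] := eqVneq a (x : Zt); last first.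
    rewrite mulr0n big1_seq // => c /andP[_ gc]; case: eqP => // e.
    case: (uniq_xy a c) => //; [by rewrite mcoeff_neq0|by rewrite mcoeff_neq0|].
    by move=> ax; rewrite ax eqxx in xa.
  rewrite mulr1n xa.
  have [gy|gy] := boolP ((y : Zt) \in msupp g); last first.
    rewrite (mcoeff_outdom gy) mulr0 big1_seq // => c /andP[_ gc].
    have [/addrI e|//] := eqVneq; by rewrite -e gc in gy.
  rewrite (bigD1_seq (y : Zt)) ?fset_uniq //= eqxx big1 ?addr0 // => c ne.
  by rewrite (inj_eq (addrI _)) (negPf ne).
have [fx|fx] := boolP ((x : Zt) \in msupp f).
  rewrite (bigD1_seq (x : Zt)) ?fset_uniq //= eqxx big1 ?addr0 //.
  by move=> c /negPf ->.
rewrite (mcoeff_outdom fx) mul0r big1_seq // => a /andP[_ fa].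
by have [e|//] := eqVneq; rewrite -e fa in fx.
Qed.

Lemma extremalM f g a b c d : extremal f a b -> extremal g c d ->
  [/\ extremal (f * g) (a + c) (b + d),
      mcoeff (a + c : Zt) (f * g) = mcoeff (a : Zt) f * mcoeff (c : Zt) g
    & mcoeff (b + d : Zt) (f * g) = mcoeff (b : Zt) f * mcoeff (d : Zt) g].
Proof.
case=> fa fb fab [gc gd gcd].
have lo : mcoeff (a + c : Zt) (f * g) = mcoeff (a : Zt) f * mcoeff (c : Zt) g.
  apply: laurent_coefM_uniq => i j /fab /andP[ai _] /gcd /andP[cj _].
  by move=> e; split; lia.
have hi : mcoeff (b + d : Zt) (f * g) = mcoeff (b : Zt) f * mcoeff (d : Zt) g.
  apply: laurent_coefM_uniq => i j /fab /andP[_ ib] /gcd /andP[_ jd].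
  by move=> e; split; lia.
split=> //; split; rewrite ?lo ?hi ?mulf_neq0 //.
move=> k; apply: contraNT => out; rewrite laurent_coefM big1_seq //.
move=> i /andP[_ fi]; rewrite big1_seq // => j /andP[_ gj].
rewrite -mcoeff_neq0 in fi; rewrite -mcoeff_neq0 in gj.
case: eqP => // e; case/negP: out; rewrite -e.
by have /andP[ai ib] := fab _ fi; have /andP[cj jd] := gcd _ gj; rewrite !lerD.
Qed.

(** Extremal coefficients are multiplicative, so mutual divisibility forces
    equal widths and makes the extremal coefficients of either element
    divide those of the other. *)
Lemma extremal_associated (D delta : laurent R) (lo hi : int) :
  divides D delta -> divides delta D -> extremal delta lo hi ->
  mcoeff (lo : Zt) delta \is a GRing.unit ->
  mcoeff (hi : Zt) delta \is a GRing.unit ->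
  [/\ ldeg D = hi - lo, leading_coef D \is a GRing.unit
    & trailing_coef D \is a GRing.unit].
Proof.
case=> a da [b db] ed.
have d0 : delta != 0.
  by case: ed => + _ _; apply: contraNneq => ->; rewrite mcoeff0.
have D0 : D != 0 by apply: contraNneq d0 => D0; rewrite da D0 mulr0.
have a0 : a != 0 by apply: contraNneq d0 => a0; rewrite da a0 mul0r.
have b0 : b != 0 by apply: contraNneq D0 => b0; rewrite db b0 mul0r.
have [[ea eb] eD] := (extremal_exps a0, extremal_exps b0, extremal_exps D0).
have [] := extremalM ea eD; rewrite -da => /extremal_eq[lo1 hi1] clo chi.
have [/extremal_eq[lo2 hi2] _ _] := extremalM eb ed; rewrite -db in lo2 hi2.
have [lo3 hi3] := extremal_eq ed; rewrite lo3 in lo1; rewrite hi3 in hi1.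
rewrite -lo1 in clo; rewrite -hi1 in chi; rewrite clo chi => ulo uhi.
have width f : f != 0 -> lowexp f <= highexp f.
  by case/extremal_exps => fl _ /(_ _ fl)/andP[].
split; first by rewrite /ldeg; have := width _ a0; have := width _ b0; lia.
  by move: uhi; rewrite unitrM => /andP[].
by move: ulo; rewrite unitrM => /andP[].
Qed.

End LaurentExtremes.

(** * Matrix pencils over Laurent polynomials *)

Section Pencil.
Variable R : comNzRingType.

Lemma lconst_is_zmod_morphism : zmod_morphism (@lconst R).
Proof. by move=> a b; apply: (raddfB (mkmalgU (1%g : Zt))). Qed.

Lemma lconst_is_monoid_morphism : monoid_morphism (@lconst R).
Proof. by split=> // a b; rewrite /lconst grelt_mul mulg1. Qed.

HB.instance Definition _ :=
  GRing.isZmodMorphism.Build R (laurent R) (@lconst R) lconst_is_zmod_morphism.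
HB.instance Definition _ :=
  GRing.isMonoidMorphism.Build R (laurent R) (@lconst R)
    lconst_is_monoid_morphism.

Local Notation t := (lmon R tgen).

Lemma lconst_mul_texp c i : lconst c * t ^+ i = grelt c (i%:Z : Zt).
Proof.
have -> : t ^+ i = lmon R (i%:Z : Zt).
  elim: i => [|i IH] //; rewrite exprS IH [LHS]grelt_mul mulr1.
  by congr grelt; rewrite -add1n PoszD.
by rewrite [LHS]grelt_mul mulr1; congr grelt; apply: add0r.
Qed.

Definition lpoly (p : {poly R}) : laurent R := (map_poly (@lconst R) p).[t].

Lemma coef_lpoly p (k : int) :
  mcoeff (k : Zt) (lpoly p) = \sum_(i < size p) p`_i *+ (i%:Z == k).
Proof.
have -> : lpoly p = \sum_(i < size p) grelt p`_i (i%:Z : Zt).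
  rewrite /lpoly (horner_coef_wide _ (size_poly _ _)); apply: eq_bigr => i _.
  by rewrite coef_map; apply: lconst_mul_texp.
rewrite (raddf_sum (mcoeff (k : Zt))); apply: eq_bigr => i _.
exact: mcoeffU.
Qed.

(** The pencil is [P (t - Q J)], so that its determinant is a constant times
    the characteristic polynomial of [Q J]. *)
Lemma det_pencil l (P Q J : 'M[R]_l) : P *m Q = 1%:M ->
  \det (t *: map_mx (@lconst R) P - map_mx (@lconst R) J) =
  lpoly (\det P *: char_poly (Q *m J)).
Proof.
move=> PQ.
have comm_t : commr_rmorph (@lconst R) t by move=> c; apply: mulrC.
pose eta : {rmorphism {poly R} -> laurent R} := horner_morph comm_t.
have -> : t *: map_mx (@lconst R) P - map_mx (@lconst R) J =
    map_mx eta (map_mx polyC P *m char_poly_mx (Q *m J)).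
  rewrite /char_poly_mx mulmxBr -map_mxM mulmxA PQ mul1mx mul_mx_scalar.
  apply/matrixP=> i j; rewrite !mxE (rmorphB eta) (rmorphM eta) /=.
  by rewrite horner_morphX !horner_morphC.
by rewrite det_map_mx det_mulmx det_map_mx -mul_polyC.
Qed.

End Pencil.

Lemma extremal_lpoly (R : idomainType) (p : {poly R}) :
  p`_0 != 0 ->
  [/\ extremal (lpoly p) 0 (size p).-1%:Z,
      mcoeff ((0 : int) : Zt) (lpoly p) = p`_0
    & mcoeff ((size p).-1%:Z : Zt) (lpoly p) = lead_coef p].
Proof.
move=> p0; have pn0 : p != 0 by apply: contraNneq p0 => ->; rewrite coef0.
have coef_nat (j : nat) : (j < size p)%N -> mcoeff (j%:Z : Zt) (lpoly p) = p`_j.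
  move=> lt_j; rewrite coef_lpoly (bigD1 (Ordinal lt_j)) //= eqxx.
  rewrite big1 ?addr0 //.
  by move=> i; rewrite -val_eqE /= => ne; rewrite eqz_nat (negPf ne).
have c0 := coef_nat 0 (_ : 0 < size p)%N; rewrite size_poly_gt0 in c0.
have {}c0 := c0 pn0.
have cd : mcoeff ((size p).-1%:Z : Zt) (lpoly p) = lead_coef p.
  by rewrite coef_nat // prednK // size_poly_gt0.
split=> //; split; first by rewrite c0.
  by rewrite cd lead_coef_eq0.
move=> k; apply: contraNT => out; rewrite coef_lpoly big1 // => i _.
case: eqP => // ei; case/negP: out; rewrite -ei /= lez_nat.
by rewrite -ltnS prednK ?size_poly_gt0 // ltn_ord.
Qed.

Lemma unit_lconst (R : idomainType) (f : laurent R) (c : R) :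
  f * lconst c = 1 -> c \is a GRing.unit.
Proof.
move=> fc; apply/unitrPr; exists (mcoeff ((0 : int) : Zt) f); rewrite mulrC.
have coefC (k : int) : mcoeff (k : Zt) (lconst c) = c *+ (k == 0).
  by rewrite [LHS]mcoeffU eq_sym.
have <- : mcoeff ((0 + 0 : int) : Zt) (f * lconst c) =
    mcoeff ((0 : int) : Zt) f * c.
  rewrite laurent_coefM_uniq ?coefC ?eqxx // => a k _; rewrite coefC addr0.
  by case: (k =P 0) => [->|]; rewrite ?eqxx // addr0.
by rewrite fc; apply: mcoeffUU.
Qed.

(** * The determinant of the cyclic extension *)

Section Monodromy.
Variables (R : comUnitRingType) (A : aug_group_system) (N : nat).
Variable gamma : {ghom A -> GL R N}.
Variables (n : nat) (b : {ghom free_group 'I_n -> A}).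
Hypothesis b_inj : injective b.
Hypothesis ker_b : forall g, ags_eps A g = 1%g <-> exists w, b w = g.

Local Notation x := (ags_elt A).
Local Notation rho := (twist gamma).
Local Notation row := (foxrow gamma b (@id 'I_n)).

(** The Fox derivatives of words in the kernel do not involve [t]. *)
Lemma foxrow_const w i j : exists c, row w i j = lconst c.
Proof.
have Phi_const f : exists C, Phi gamma b f = map_mx (@lconst R) C.
  elim/gr_ind: f => [|f g [C eC] [D eD]|c u].
  - by exists 0; rewrite map_mx0 /Phi msupp0 big_seq_fset0.
  - by exists (C + D); rewrite PhiD eC eD map_mxD.
  exists ((gamma (b u) : 'M_N) *~ c); rewrite Phi_grelt (raddfMz (map_mx _)).
  have lmon1 : lmon R 1%g = 1 by [].
  by rewrite /Phi_elt (eps_b ker_b) lmon1 scale1r.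
rewrite /foxrow mxE; set k := tagnat.sig1 j; have [C ->] := Phi_const (fox k w).
by rewrite mxE; eexists.
Qed.

(** The Fox Jacobian of the endomorphism [a_j |-> phi j] of the free group. *)
Definition monodromy_mx (phi : 'I_n -> free_group 'I_n) :
    'M[laurent R]_(\sum_(j < n) N) :=
  \mxcol_(j < n) row (phi j).

(** The substitution [a_j |-> phi j] is an automorphism [Psi] of the free
    group, so by the chain rule its Fox Jacobian is invertible.  The twist
    changes under [Psi] by conjugation by [rho x], which accounts for the
    block diagonal matrix [Q] of [rho x^-1]. *)
Lemma monodromy_mx_linv phi :
  (forall j, b (phi j) = (x * b (fgen j) * x^-1)%g) ->
  exists Y, Y *m monodromy_mx phi = 1%:M.
Proof.
move=> phiP; set J := monodromy_mx phi.
have [Psi PsiP PsiM] := inner_lift b_inj ker_b x.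
pose Q : 'M_(\sum_(j < n) N) := \mxcol_(j < n) (rho x^-1%g *m submxcol 1%:M j).
have chain v : row (Psi v) = rho x *m row v *m (Q *m J).
  suff [C] : eqrow (0 : 'M_(1, _)) (row (Psi v)) (rho x *m row v *m (Q *m J)).
    by rewrite mulmx0 => /eqP; rewrite subr_eq0 => /eqP.
  move: v; apply: (der_mod_free (sigma := fun w => rho (b (Psi w)))).
  - by rewrite PsiP gmulf1 mulg1 mulgV twist1.
  - by apply: derivation_modW => u w; rewrite PsiM foxrow_der.
  - apply/derivation_modW/derivation_mulr/derivation_mull/foxrow_der => u.
    by rewrite PsiP; apply: twist_conj.
  move=> j; rewrite (_ : Psi (fgen j) = phi j); last first.
    by apply: b_inj; rewrite PsiP phiP.
  rewrite (foxrow_id_gen gamma b) -mulmxA submxcol_mul mul1mx -submxcol_mul.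
  rewrite mxcolK !mulmxA twistKV mul1mx submxcol_mul mul1mx mxcolK.
  exact: eqrow_refl.
have [s sP] := ker_section ker_b.
(* The words [s (x^-1 a_j x)] are the preimages under [Psi] of the [a_j]. *)
exists (\mxcol_(j < n) (rho x *m row (s (x^-1 * b (fgen j) * x)%g) *m Q)).
rewrite mxcol_mul -[RHS]submxcolK; apply: eq_mxcol => j.
rewrite -mulmxA -chain -(foxrow_id_gen gamma b); congr foxrow; apply: b_inj.
rewrite PsiP sP; first by rewrite !mulgA mulgV mul1g mulgK.
by rewrite -{2}[x]invgK; apply: (eps_conj ker_b).
Qed.

End Monodromy.

(** Up to the unit [det P], where [P] is block diagonal with blocks [gamma x],
    this determinant is the characteristic polynomial of [P^-1 J], where [J] is
    the Fox Jacobian of conjugation by [x]. *)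
Lemma det_conj_matrix (R : idomainType) (A : aug_group_system) (N : nat)
    (gamma : {ghom A -> GL R N}) (heps : ags_eps A (ags_elt A) = tgen)
    (n : nat) (b : {ghom free_group 'I_n -> A}) (b_inj : injective b)
    (ker_b : forall g, ags_eps A g = 1%g <-> exists w, b w = g) phi :
  (forall j, b (phi j) = (ags_elt A * b (fgen j) * (ags_elt A)^-1)%g) ->
  exists p : {poly R},
    [/\ \det (conj_matrix gamma b phi) = lpoly p, size p = (n * N).+1,
        p`_0 \is a GRing.unit & lead_coef p \is a GRing.unit].
Proof.
move=> phiP; set x := ags_elt A; set l := (\sum_(j < n) N)%N.
have sz_l : l = (n * N)%N by rewrite /l sum_nat_const card_ord.
pose X : 'M[R]_N := gamma x; pose X' : 'M[R]_N := gamma x^-1%g.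
have XX' : X *m X' = 1%:M.
  have -> : X *m X' = (gamma x * gamma x^-1)%g by [].
  by rewrite -gmulfM mulgV gmulf1.
pose P : 'M[R]_l := \mxcol_(j < n) (X *m submxcol 1%:M j).
pose Q : 'M[R]_l := \mxcol_(j < n) (X' *m submxcol 1%:M j).
have PQ : P *m Q = 1%:M.
  rewrite mxcol_mul -[RHS]submxcolK; apply: eq_mxcol => j.
  by rewrite -mulmxA submxcol_mul mul1mx mxcolK mulmxA XX' mul1mx.
have unitP : \det P \is a GRing.unit.
  have := congr1 determinant PQ; rewrite det_mulmx det1 => e.
  by apply/unitrPr; exists (\det Q).
(* The entries are constants, so they descend from [laurent R] to [R]. *)
have [J eJ] : exists J, monodromy_mx gamma b phi = map_mx (@lconst R) J.
  exists (map_mx (mcoeff (1%g : Zt)) (monodromy_mx gamma b phi) : 'M[R]_l).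
  apply/matrixP=> i j; have [c e] :
      exists c, monodromy_mx gamma b phi i j = lconst c.
    by rewrite /monodromy_mx mxE; apply: foxrow_const.
  rewrite e [RHS]mxE; congr lconst.
  by rewrite mxE e [RHS]mcoeffUU.
have unitJ : \det J \is a GRing.unit.
  have [Y] := monodromy_mx_linv gamma b_inj ker_b phiP; rewrite eJ.
  move=> /(congr1 determinant); rewrite det_mulmx det1 det_map_mx.
  exact: unit_lconst.
exists (\det P *: char_poly (Q *m J)).
have size_p : size (\det P *: char_poly (Q *m J)) = (n * N).+1.
  by rewrite size_scale ?size_char_poly ?sz_l //;
    apply: contraTneq unitP => ->; rewrite unitr0.
split=> //.
- rewrite -(det_pencil _ PQ) -eJ; congr (\det _).
  rewrite /conj_matrix mxcolB; congr (_ - _).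
  have -> : lmon R tgen *: map_mx (@lconst R) P =
      \mxcol_(j < n) (lmon R tgen *: map_mx (@lconst R) (X *m submxcol 1%:M j)).
    by apply/matrixP=> i j; rewrite !mxE.
  apply: eq_mxcol => j; rewrite map_mxM /= /twist heps -scalemxAl.
  congr (_ *: (_ *m _)); rewrite -(map_mx1 (@lconst R)).
  by apply/matrixP=> i k; rewrite !mxE.
- rewrite coefZ char_poly_det det_mulmx !unitrM unitP unitrX ?unitrN ?unitr1 //.
  rewrite unitJ andbT.
  have := congr1 determinant PQ; rewrite det_mulmx det1 mulrC => e.
  by apply/unitrPr; exists (\det P).
by rewrite lead_coefZ (monicP (char_poly_monic _)) mulr1.
Qed.

Theorem theorem2p6 (R : idomainType) (hnoeth : noetherian R) (hufd : ufd R)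
    (A : aug_group_system) (heps : ags_eps A (ags_elt A) = tgen)
    (n : nat) (hker : kernel_free_of_rank (ags_eps A) n)
    (N : nat) (hN : (0 < N)%N) (gamma : {ghom A -> GL R N})
    (D : laurent R) (hD : is_alexander_lin gamma D) :
  ldeg D = (n * N)%N%:Z /\
  (leading_coef D \is a GRing.unit /\ trailing_coef D \is a GRing.unit).
Proof.
case: hker => b [b_inj ker_b].
have [s sP] := ker_section ker_b.
pose phi j := s (ags_elt A * b (fgen j) * (ags_elt A)^-1)%g.
have phiP j : b (phi j) = (ags_elt A * b (fgen j) * (ags_elt A)^-1)%g.
  by apply/sP/(eps_conj ker_b).
have [d0 ud0] := conj_matrix_universal gamma heps b_inj ker_b phiP.
have [p [det_p size_p p0 lead_p]] :=
  det_conj_matrix gamma heps b_inj ker_b phiP.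
case: hD => q [m [pi [r [pres pi0 _ [D_div D_max]]]]].
have [d ud] := alexander_universal gamma pres pi0.
have [minor_div div_minor] := ud_square_divides ud ud0.
rewrite det_p in minor_div div_minor.
have D_delta : divides D (lpoly p).
  by apply: div_minor => s' incr; apply: D_div; exists s'.
have delta_D : divides (lpoly p) D.
  by apply: D_max => a [s' _ ->]; apply: minor_div.
have p0n : p`_0 != 0 by apply: contraTneq p0 => ->; rewrite unitr0.
have [ext c0 cd] := extremal_lpoly p0n.
have [] := extremal_associated D_delta delta_D ext; rewrite ?c0 ?cd //.
by rewrite size_p subr0.
Qed.
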